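(* Let $t$ and $n$ be positive integers and let $(A_{x_1x_2\cdots x_t})_{1\le x_1,\dots,x_t\le n}$ be a $t$-dimensional array of complex numbers. For $1\le k\le n$ and $1\le m\le t$ put $$\Sigma_{t-m}(k)=\sum_{1\leq i_1<i_2<\cdots<i_m\leq t}\ \sum_{x}A_{x_1x_2\cdots x_t},$$ where the inner sum runs over all $x=(x_1,\dots,x_t)$ with $x_{i_1}=x_{i_2}=\cdots=x_{i_m}=k$ and $1\le x_j\le k$ for every $j\notin\{i_1,\dots,i_m\}$. Then $$\sum_{k=1}^n\ \sum_{m=1}^t(-1)^{m-1}\Sigma_{t-m}(k)=\sum_{1\le x_1,\dots,x_t\le n}A_{x_1x_2\cdots x_t}.$$
   Context: All indices $x_1,\dots,x_t$ range over integers. When $m=t$ the inner sum has the single term $A_{kk\cdots k}$. *)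

(* Defs.v *)
From HB Require Import structures.
From mathcomp Require Import all_boot all_order all_algebra.
From mathcomp Require Import reals.
From mathcomp Require Export complex.

Set Implicit Arguments.
Unset Strict Implicit.
Unset Printing Implicit Defensive.

Import Order.TTheory GRing.Theory Num.Theory.
Local Open Scope ring_scope.

(* The index range {1, ..., n} is encoded by 'I_n, the ordinal of value v
   standing for the index v + 1.  Indices are only tested for equality and
   compared with each other, so the shift does not affect any condition.

   [Sigma A m k] is \Sigma_{t-m}(k): the second argument is the number m of
   coordinates forced to be equal to k, not the number t - m of free ones.
   The tuple i is the list i_1 < ... < i_m of forced positions. *)
Definition Sigma (R : realType) (t n : nat) (A : {ffun 'I_t -> 'I_n} -> R[i])
    (m : nat) (k : 'I_n) : R[i] :=
  \sum_(i : m.-tuple 'I_t | sorted ltn [seq val j | j <- i])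
    \sum_(x : {ffun 'I_t -> 'I_n} |
        [forall j in i, x j == k] &&
        [forall (j | j \notin i), (x j <= k)%N]) A x.

(* Main.v *)
(** Fix [x]. Expanding the product over [j] of [x_j <= k] - [x_j = k] (Iverson
    brackets) over the set [I] of coordinates where the second bracket is chosen
    gives the signed sum of the conditions defining [Sigma A m k], together with
    the term of the empty [I], which is [max x <= k]. As the product itself is
    [max x < k], the total coefficient of [A x] at [k] is
    [max x <= k] - [max x < k], and the sum over [k] telescopes to 1. *)
Require Import Defs.
From HB Require Import structures.
From mathcomp Require Import all_boot all_order all_algebra.
From mathcomp Require Import reals.
From mathcomp Require Import complex.

Set Implicit Arguments.
Unset Strict Implicit.
Unset Printing Implicit Defensive.

Import Order.TTheory GRing.Theory Num.Theory.
Local Open Scope ring_scope.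

Lemma sorted_enum_ord t (I : {set 'I_t}) : sorted ltn [seq val j | j <- enum I].
Proof.
rewrite sorted_map; apply: sorted_filter.
  by move=> a b c; apply: ltn_trans.
by rewrite -sorted_map -enumT val_enum_ord iota_ltn_sorted.
Qed.

(** A strictly increasing tuple is determined by its set of entries, and [enum I] lists any [I]
    increasingly, so the choices of positions are exactly the subsets of size [m]. *)
Lemma sum_sorted_tuples (V : nmodType) t m (F : {set 'I_t} -> V) :
  \sum_(i : m.-tuple 'I_t | sorted ltn [seq val j | j <- i])
    F [set j in tval i] = \sum_(I : {set 'I_t} | #|I| == m) F I.
Proof.
pose B := [set i : m.-tuple 'I_t | sorted ltn [seq val j | j <- i]].
rewrite (eq_bigl [in B]); last by move=> i; rewrite inE.
rewrite -(big_imset F (h := fun i : m.-tuple 'I_t => [set j in tval i])) /=.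
  apply: eq_bigl => I; apply/imsetP/eqP => [[s] | cI].
    rewrite inE => ss ->; rewrite cardsE (card_uniqP _) ?size_tuple //.
    by rewrite -(map_inj_uniq val_inj) (sorted_uniq ltn_trans ltnn ss).
  have sz : size (enum I) == m by rewrite -cardE cI.
  exists (Tuple sz); first by rewrite inE sorted_enum_ord.
  by apply/setP => j; rewrite inE mem_enum.
move=> i j; rewrite !inE => si sj eij; apply/val_inj/(inj_map val_inj).
apply: (irr_sorted_eq ltn_trans ltnn si sj).
by apply/eq_mem_map => a; have /setP/(_ a) := eij; rewrite !inE.
Qed.

(** Only [m = #|I|] contributes for a given [I], and it lies in the range exactly when [I] is
    nonempty. *)
Lemma sum_by_card (V : nmodType) t (G : {set 'I_t} -> V) :
  \sum_(1 <= m < t.+1) \sum_(I : {set 'I_t} | #|I| == m) G I =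
  \sum_(I : {set 'I_t} | I != set0) G I.
Proof.
under eq_bigr => m _ do rewrite big_mkcond.
rewrite exchange_big [RHS]big_mkcond; apply: eq_bigr => I _ /=.
rewrite -big_mkcond; under eq_bigl => m do rewrite eq_sym.
by rewrite big_nat1_eq card_gt0 ltnS -[leqRHS]card_ord max_card andbT.
Qed.

Lemma prodr_forall (R : comPzRingType) (T : finType) (P b : pred T) :
  \prod_(j | P j) (b j)%:R = [forall (j | P j), b j]%:R :> R.
Proof.
case: forall_inP => [Pb | nPb]; first by rewrite big1 // => j /Pb ->.
have [j Pj /negPf bj] : exists2 j, P j & ~~ b j.
  by apply/exists_inP; rewrite -negb_forall_in; apply/forall_inP.
by rewrite (bigD1 j) //= bj mul0r.
Qed.

Lemma sum_sign_forall (R : comNzRingType) (T : finType) (b c : pred T) :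
  \sum_(I : {set T}) (-1) ^+ #|I| *
    ([forall j in I, c j] && [forall (j | j \notin I), b j])%:R =
  \prod_j ((b j)%:R - (c j)%:R) :> R.
Proof.
(* The summands are swapped so that, in [bigA_distr], [I] collects the factors contributing
   [- c j]. *)
under [RHS]eq_bigr => j _ do rewrite addrC.
rewrite bigA_distr; apply: eq_bigr => I _.
rewrite (bigID [in I]) /= -mulnb natrM mulrA; congr (_ * _).
  rewrite (eq_bigr (fun j => - 1 * (c j)%:R)) => [|j ->]; last by rewrite mulN1r.
  by rewrite big_split /= prodr_const prodr_forall.
rewrite -prodr_forall; apply: eq_bigr => j; by move=> /negPf ->.
Qed.

Theorem mainTheorem8 (R : realType) (t n : nat) (ht : (0 < t)%N)
    (hn : (0 < n)%N) (A : {ffun 'I_t -> 'I_n} -> R[i]) :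
  \sum_(k < n) \sum_(1 <= m < t.+1) (-1) ^+ (m - 1) * Sigma A m k =
  \sum_(x : {ffun 'I_t -> 'I_n}) A x.
Proof.
pose C (k : 'I_n) (x : {ffun 'I_t -> 'I_n}) (I : {set 'I_t}) :=
  [forall j in I, x j == k] && [forall (j | j \notin I), (x j <= k)%N].
(* Here [k] is a natural number, not an ordinal: [N x k.+1] encodes max x <= k even at the last
   index, where it is [N x n]. *)
pose N (x : {ffun 'I_t -> 'I_n}) k : R[i] := [forall j, (x j < k)%N]%:R.
have SigmaE m k : Sigma A m k =
    \sum_(I : {set 'I_t} | #|I| == m) \sum_x (C k x I)%:R * A x.
  rewrite -sum_sorted_tuples; apply: eq_bigr => i _.
  rewrite big_mkcond; apply: eq_bigr => x _.
  have -> : C k x [set j in tval i] =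
      [forall j in i, x j == k] && [forall (j | j \notin i), (x j <= k)%N].
    by congr (_ && _); apply: eq_forallb => j; rewrite inE.
  by case: ifP => _; rewrite ?mul1r ?mul0r.
have coefE k x : \sum_(I : {set 'I_t} | I != set0) (-1) ^+ #|I| * (C k x I)%:R =
    N x k - N x k.+1.
  (* Adding the term of the empty set to both sides completes the sum over all [I]. *)
  apply: (addrI ((-1) ^+ #|@set0 'I_t| * (C k x set0)%:R)).
  have := sum_sign_forall R[i] (fun j => x j <= k)%N (fun j => x j == k).
  rewrite (bigD1 set0) //= => ->; rewrite /N.
  rewrite (eq_bigr (fun j => (x j < k)%N%:R)); last first.
    move=> j _; rewrite ltn_neqAle -val_eqE /=.
    by case: eqP => [->|_] /=; rewrite ?leqnn ?subrr ?subr0.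
  rewrite prodr_forall cards0 mul1r addrCA -[LHS]addr0; congr (_ + _).
  suff -> : C k x set0 = [forall j, (x j < k.+1)%N] by rewrite subrr.
  rewrite /C; have -> : [forall j in set0, x j == k].
    by apply/forall_inP => j; rewrite inE.
  by apply: eq_forallb => j; rewrite inE.
transitivity (\sum_(k < n) \sum_x (N x k.+1 - N x k) * A x).
  apply: eq_bigr => k _.
  pose G (I : {set 'I_t}) : R[i] := (-1) ^+ #|I| * \sum_x (C k x I)%:R * A x.
  transitivity (- \sum_(I : {set 'I_t} | I != set0) G I).
    (* Since [m] starts at 1, the truncated [m - 1] is a true predecessor, so its sign is opposite
       to that of [m]. *)
    rewrite -sum_by_card -sumrN; apply: eq_big_nat => -[|m] // _.
    rewrite subn1 SigmaE mulr_sumr -sumrN; apply: eq_bigr => I /eqP cI.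
    by rewrite /G cI exprS mulN1r mulNr opprK.
  rewrite -sumrN; under eq_bigr => I _ do rewrite /G mulr_sumr -sumrN.
  rewrite exchange_big /=; apply: eq_bigr => x _.
  rewrite -[N x k.+1 - _]opprB -coefE mulNr mulr_suml -sumrN.
  by apply: eq_bigr => I _; rewrite mulrA.
rewrite exchange_big; apply: eq_bigr => x _ /=.
rewrite -mulr_suml -(big_mkord predT (fun k => N x k.+1 - N x k)).
(* What remains is [N x n - N x 0]. The first term is 1; the second is 0 because [ht] provides a
   coordinate, without which the condition would hold vacuously. *)
rewrite telescope_sumr // /N.
have -> : [forall j, (x j < n)%N] by apply/forallP.
suff -> : [forall j, (x j < 0)%N] = false by rewrite subr0 mul1r.
by apply/forallP => /(_ (Ordinal ht)).
Qed.
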